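(* Suppose Assumption 1 (stated in the context) holds. Let $(x^{k_j})_{j\in\mathbb{N}}$ be a bounded subsequence of a sequence $(x^k)_{k\in\mathbb{N}}$ generated by the ARBPG algorithm (described in the context), and let $\Theta_k:=[\tau_{k,1}U_1,\ldots,\tau_{k,N}U_N]$ be the diagonal matrices of accepted stepsizes (defined in the context). Then there exists a constant $\underline\theta>0$ such that $\Theta_{k_j}\succeq\underline\theta I_n$ for all $j\ge0$.
   Context: Notation. $\overline{\mathbb{R}}=\mathbb{R}\cup\{\pm\infty\}$; $\|\cdot\|$ is the Euclidean norm; $\mathbb{N}=\{0,1,2,\ldots\}$; $A\succeq B$ means $A-B$ is positive semidefinite. Vectors $x\in\mathbb{R}^n$ are split into $N\ge1$ blocks $x_i\in\mathbb{R}^{n_i}$, $\sum_{i=1}^N n_i=n$. Write the identity as $I_n=[U_1,\ldots,U_N]$ with $U_i\in\mathbb{R}^{n\times n_i}$, so $x_i=U_i^Tx$, and $\nabla_i f(x):=U_i^T\nabla f(x)$. For $h:\mathbb{R}^m\to\overline{\mathbb{R}}$, $\operatorname{dom}h=\{x: h(x)<+\infty\}$; $h$ is proper if it never takes the value $-\infty$ and $\operatorname{dom}h\ne\emptyset$; lsc means lower semicontinuous. $\operatorname{prox}_h(x):=\operatorname{argmin}_{u}\{h(u)+\frac12\|x-u\|^2\}$ (set-valued). $h$ is prox-bounded if $h+\frac{1}{2\tau}\|\cdot\|^2$ is bounded from below on $\mathbb{R}^m$ for some $\tau>0$; the supremum of such $\tau$ is the prox-boundedness threshold $\tau^h\in(0,+\infty]$.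 A smooth function is a differentiable function with continuous gradient. Assumption 1. $\varphi=f+g$ where: (i) $f:\mathbb{R}^n\to\mathbb{R}$ is smooth and for every $\bar x\in\operatorname{dom}g$ there exist convex neighborhoods $V_i$ of $\bar x$ and constants $L_i(\bar x)>0$ such that for all $i\in\{1,\ldots,N\}$, $\|\nabla_i f(x+U_is_i)-\nabla_i f(x)\|\le L_i(\bar x)\|s_i\|$ for all $x,\,x+U_is_i\in V_i$; (ii) $g:\mathbb{R}^n\to\overline{\mathbb{R}}$ has the form $g(x)=\sum_{i=1}^N g_i(x_i)$ with each $g_i:\mathbb{R}^{n_i}\to\overline{\mathbb{R}}$ proper, lsc and prox-bounded; (iii) $\inf_{x\in\mathbb{R}^n}\varphi(x)>-\infty$. ARBPG algorithm. Input: $x^0\in\operatorname{dom}\varphi$; $0<\underline\tau\le\bar\tau$; $a,\alpha>0$; $\beta\in(0,1)$; probabilities $p_1,\ldots,p_N>0$ with $\sum_i p_i=1$. For $k=0,1,2,\ldots$: 1. Draw a random block index $i_k\in\{1,\ldots,N\}$ with $\mathbb{P}(i_k=i)=p_i$. 2. Choose $\bar\tau_k\in[\underline\tau,\min\{\bar\tau,\tau^{g_{i_k}}\})$; set $t=0$. 3. Set $\tau_k:=\beta^t\bar\tau_k$ and compute $d^k\in\mathbb{R}^n$ with $d^k_i=0$ for $i\ne i_k$ and $d^k_{i_k}\in\operatorname{prox}_{\tau_kg_{i_k}}\big(x^k_{i_k}-\tau_k\nabla_{i_k}f(x^k)\big)-x^k_{i_k}$. 4. If $d^k_{i_k}=0$,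 set $x^{k+1}:=x^k$ and pass to iteration $k+1$. 5. If $\varphi(x^k+d^k)\le\varphi(x^k)-a\|d^k\|^2$, set $\hat x^k:=x^k+d^k$ and go to step 6; otherwise increase $t$ by $1$ and return to step 3. 6. Pick any $\lambda_k\ge0$ such that $\varphi(\hat x^k+\lambda_kd^k)\le\varphi(\hat x^k)-\alpha\lambda_k^2\|d^k\|^2$ ($\lambda_k=0$ is allowed). 7. Set $x^{k+1}:=\hat x^k+\lambda_kd^k$ and pass to iteration $k+1$. Accepted stepsizes. For each $k\ge0$ and each $i\in\{1,\ldots,N\}$ (not only the index actually drawn), $\tau_{k,i}>0$ denotes the stepsize that the backtracking loop (steps 2–5), started from $x^k$, accepts at iteration $k$ if $i_k=i$. That is, $\tau_{k,i}=\beta^{t}\bar\tau_k$ with trial stepsize $\bar\tau_k\in[\underline\tau,\min\{\bar\tau,\tau^{g_i}\})$ (which may depend on $i$), where $t\in\mathbb{N}$ is the first counter value at which the computed direction is zero or satisfies the decrease condition of step 5. The statement is pathwise: it concerns any fixed realization of the algorithm. *)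

(* Defs.v *)
From mathcomp Require Import all_boot all_order all_algebra.
From mathcomp Require Import all_classical all_reals all_analysis.
Set Implicit Arguments.
Unset Strict Implicit.
Unset Printing Implicit Defensive.
Import Order.TTheory GRing.Theory Num.Theory.
Import numFieldNormedType.Exports.

Local Open Scope classical_set_scope.
Local Open Scope ring_scope.

(* The library's norm `|_| on matrices is the sup norm, hence this one. *)
Definition enorm (R : realType) (m : nat) (v : 'cV[R]_m) : R :=
  Num.sqrt (\sum_i v i 0 ^+ 2).

Definition psd (R : realType) (m : nat) (A : 'M[R]_m) : Prop :=
  A^T = A /\ forall v : 'cV[R]_m, 0 <= (v^T *m A *m v) 0 0.

Definition loewner_ge (R : realType) (m : nat) (A B : 'M[R]_m) : Prop :=
  psd (A - B).

Definition dom (R : realType) (m : nat) (h : 'cV[R]_m -> \bar R) :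
    set 'cV[R]_m :=
  [set x | (h x < +oo)%E].

Definition proper (R : realType) (m : nat) (h : 'cV[R]_m -> \bar R) : Prop :=
  (forall x, h x <> -oo%E) /\ dom h !=set0.

Definition bounded_below (R : realType) (m : nat) (h : 'cV[R]_m -> \bar R) :
    Prop :=
  exists b : R, forall x, (b%:E <= h x)%E.

Definition prox_bounds (R : realType) (m : nat) (h : 'cV[R]_m -> \bar R) :
    set R :=
  [set tau | 0 < tau /\
    bounded_below (fun x => h x + ((2 * tau)^-1 * enorm x ^+ 2)%:E)%E].

Definition prox_bounded (R : realType) (m : nat) (h : 'cV[R]_m -> \bar R) :
    Prop :=
  prox_bounds h !=set0.

Definition prox_threshold (R : realType) (m : nat) (h : 'cV[R]_m -> \bar R) :
    \bar R :=
  ereal_sup (EFin @` prox_bounds h).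

Definition argmin (R : realType) (m : nat) (h : 'cV[R]_m -> \bar R) :
    set 'cV[R]_m :=
  [set u | forall v, (h u <= h v)%E].

Definition prox (R : realType) (m : nat) (h : 'cV[R]_m -> \bar R)
    (x : 'cV[R]_m) : set 'cV[R]_m :=
  argmin (fun u => h u + (2^-1 * enorm (x - u) ^+ 2)%:E)%E.

Definition grad (R : realType) (m : nat) (f : 'cV[R]_m -> R) (x : 'cV[R]_m) :
    'cV[R]_m :=
  \col_i 'D_(delta_mx i 0) f x.

Definition smooth (R : realType) (m : nat) (f : 'cV[R]_m -> R) : Prop :=
  (forall x, differentiable f x) /\ continuous (grad f).

(* The N blocks have sizes n_ 0, ..., n_ (N - 1), and the whole space is
   R^n with n = \sum_i n_ i; [blockU n_ i] is U_i, that is,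
   1%:M = \mxrow_i blockU n_ i. *)
Definition blockU (R : realType) (N : nat) (n_ : 'I_N -> nat) (i : 'I_N) :
    'M[R]_(\sum_i n_ i, n_ i) :=
  submxrow 1%:M i.

Definition block (R : realType) (N : nat) (n_ : 'I_N -> nat) (i : 'I_N)
    (x : 'cV[R]_(\sum_i n_ i)) : 'cV[R]_(n_ i) :=
  (blockU R n_ i)^T *m x.

Definition bgrad (R : realType) (N : nat) (n_ : 'I_N -> nat) (i : 'I_N)
    (f : 'cV[R]_(\sum_i n_ i) -> R) (x : 'cV[R]_(\sum_i n_ i)) :
    'cV[R]_(n_ i) :=
  (blockU R n_ i)^T *m grad f x.

Definition separable (R : realType) (N : nat) (n_ : 'I_N -> nat)
    (g : forall i, 'cV[R]_(n_ i) -> \bar R) (x : 'cV[R]_(\sum_i n_ i)) :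
    \bar R :=
  (\sum_i g i (block i x))%E.

Definition objective (R : realType) (N : nat) (n_ : 'I_N -> nat)
    (f : 'cV[R]_(\sum_i n_ i) -> R) (g : forall i, 'cV[R]_(n_ i) -> \bar R)
    (x : 'cV[R]_(\sum_i n_ i)) : \bar R :=
  ((f x)%:E + separable g x)%E.

Definition block_lipschitz_at (R : realType) (N : nat) (n_ : 'I_N -> nat)
    (f : 'cV[R]_(\sum_i n_ i) -> R) (xbar : 'cV[R]_(\sum_i n_ i)) : Prop :=
  exists (V : 'I_N -> set 'cV[R]_(\sum_i n_ i)) (L : 'I_N -> R), forall i,
    [/\ nbhs xbar (V i), convex_set (V i), 0 < L i &
        forall (x : 'cV[R]_(\sum_i n_ i)) (s : 'cV[R]_(n_ i)),
          V i x -> V i (x + blockU R n_ i *m s) ->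
          enorm (bgrad i f (x + blockU R n_ i *m s) - bgrad i f x)
            <= L i * enorm s].

Record standing_assumption (R : realType) (N : nat) (n_ : 'I_N -> nat)
    (f : 'cV[R]_(\sum_i n_ i) -> R) (g : forall i, 'cV[R]_(n_ i) -> \bar R) :
    Prop := StandingAssumption {
  sa_smooth : smooth f;
  sa_lipschitz : forall xbar, dom (separable g) xbar ->
    block_lipschitz_at f xbar;
  sa_proper : forall i, proper (g i);
  sa_lsc : forall i, lower_semicontinuous (g i);
  sa_prox_bounded : forall i, prox_bounded (g i);
  sa_inf : (-oo < ereal_inf (range (objective f g)))%E
}.

Record arbpg_params (R : realType) (N : nat) := ArbpgParams {
  tau_lo : R;
  tau_hi : R;
  dec_a : R;
  dec_alpha : R;
  shrink : R;
  prob : 'I_N -> R;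
  tau_lo_gt0 : 0 < tau_lo;
  tau_lo_hi : tau_lo <= tau_hi;
  dec_a_gt0 : 0 < dec_a;
  dec_alpha_gt0 : 0 < dec_alpha;
  shrink_gt0 : 0 < shrink;
  shrink_lt1 : shrink < 1;
  prob_gt0 : forall i, 0 < prob i;
  prob_sum1 : \sum_i prob i = 1
}.

(* A relation, because the prox is set-valued: [d] is one of the directions
   that may be computed at [x] for the block [i] and the stepsize [tau]. *)
Definition trial_direction (R : realType) (N : nat) (n_ : 'I_N -> nat)
    (f : 'cV[R]_(\sum_i n_ i) -> R) (g : forall i, 'cV[R]_(n_ i) -> \bar R)
    (x : 'cV[R]_(\sum_i n_ i)) (i : 'I_N) (tau : R)
    (d : 'cV[R]_(\sum_i n_ i)) : Prop :=
  (forall j, j != i -> block j d = 0) /\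
  exists2 u, prox (fun v => tau%:E * g i v)%E
                  (block i x - tau *: bgrad i f x) u
    & block i d = u - block i x.

Definition loop_stops (R : realType) (N : nat) (n_ : 'I_N -> nat)
    (f : 'cV[R]_(\sum_i n_ i) -> R) (g : forall i, 'cV[R]_(n_ i) -> \bar R)
    (a : R) (x : 'cV[R]_(\sum_i n_ i)) (i : 'I_N)
    (d : 'cV[R]_(\sum_i n_ i)) : Prop :=
  block i d = 0 \/
  (objective f g (x + d)
     <= objective f g x - (a * enorm d ^+ 2)%:E)%E.

(* One complete run of the backtracking loop from [x] for the block [i]: [d s]
   is the direction computed when the counter equals [s], and [t] is the value
   of the counter at which the loop is left.  The values [d s] with [t < s] are
   irrelevant. *)
Definition backtracking (R : realType) (N : nat) (n_ : 'I_N -> nat)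
    (P : arbpg_params R N) (f : 'cV[R]_(\sum_i n_ i) -> R)
    (g : forall i, 'cV[R]_(n_ i) -> \bar R) (x : 'cV[R]_(\sum_i n_ i))
    (i : 'I_N) (taubar : R) (d : nat -> 'cV[R]_(\sum_i n_ i)) (t : nat) :
    Prop :=
  [/\ tau_lo P <= taubar,
      (taubar%:E < Order.min (tau_hi P)%:E (prox_threshold (g i)))%E,
      forall s, (s <= t)%N ->
        trial_direction f g x i (shrink P ^+ s * taubar) (d s),
      forall s, (s < t)%N -> ~ loop_stops f g (dec_a P) x i (d s)
    & loop_stops f g (dec_a P) x i (d t)].

(* The passage from [x] to the next iterate [x'], where [d] is the direction at
   which the loop was left; [x + d] is the intermediate point before the
   extrapolation by [lambda]. *)
Definition update (R : realType) (N : nat) (n_ : 'I_N -> nat)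
    (f : 'cV[R]_(\sum_i n_ i) -> R) (g : forall i, 'cV[R]_(n_ i) -> \bar R)
    (alpha : R) (x : 'cV[R]_(\sum_i n_ i)) (i : 'I_N)
    (d x' : 'cV[R]_(\sum_i n_ i)) : Prop :=
  (block i d = 0 /\ x' = x) \/
  (block i d <> 0 /\
   exists lambda : R,
     [/\ 0 <= lambda,
         (objective f g (x + d + lambda *: d)
            <= objective f g (x + d) -
               (alpha * lambda ^+ 2 * enorm d ^+ 2)%:E)%E
       & x' = x + d + lambda *: d]).

(* A realization of the algorithm: [x] are the iterates, [ik k] is the block
   drawn at iteration [k] (pathwise, [prob] plays no role: any block may be drawn,
   as all probabilities are positive), and [tau k i] is the stepsize accepted by the loop started from
   [x k] for the block [i].  At each iteration there is a run of the loop for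
   every block; the iterate is updated with the run of the drawn block. *)
Definition arbpg (R : realType) (N : nat) (n_ : 'I_N -> nat)
    (P : arbpg_params R N) (f : 'cV[R]_(\sum_i n_ i) -> R)
    (g : forall i, 'cV[R]_(n_ i) -> \bar R)
    (x : nat -> 'cV[R]_(\sum_i n_ i)) (ik : nat -> 'I_N)
    (tau : nat -> 'I_N -> R) : Prop :=
  dom (objective f g) (x 0%N) /\
  exists (taubar : nat -> 'I_N -> R) (t : nat -> 'I_N -> nat)
         (d : nat -> 'I_N -> nat -> 'cV[R]_(\sum_i n_ i)),
    forall k,
      (forall i,
         backtracking P f g (x k) i (taubar k i) (d k i) (t k i) /\
         tau k i = shrink P ^+ t k i * taubar k i) /\
      update f g (dec_alpha P) (x k) (ik k) (d k (ik k) (t k (ik k))) (x k.+1).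

Definition Theta (R : realType) (N : nat) (n_ : 'I_N -> nat)
    (tau : nat -> 'I_N -> R) (k : nat) : 'M[R]_(\sum_i n_ i) :=
  \mxrow_i (tau k i *: blockU R n_ i).

(* Main.v *)
(* Fix a block [i].  On the sublevel set of [phi (x 0)], in which the iterates
   remain, [g_i (x_i)] is locally bounded above, since the other terms of [phi]
   have continuous minorants by prox-boundedness.  Comparing the prox point with
   [x_i] then gives [(1 / (2 sigma) - const) * |d|^2 <= const] locally
   uniformly, so small stepsizes force short directions.  Near a point of
   [dom g] the direction therefore stays where the block gradient is
   [L]-Lipschitz, and the prox inequality combined with the descent lemma yields
   [phi (x + d) <= phi x - (1 / (2 sigma) - L) * |d|^2], which stops the loop
   once [1 / (2 sigma) >= L + a]; near a point outside [dom g], lower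
   semicontinuity pushes [phi] above [phi (x 0)].  So every point has a
   neighborhood on which all sufficiently small stepsizes are accepted, and
   compactness makes the threshold uniform over the bounded subsequence; a
   rejected stepsize is at least the threshold, an accepted one at least
   [shrink] times it. *)
Require Import Defs.
From mathcomp Require Import all_boot all_order all_algebra.
From mathcomp Require Import all_classical all_reals all_analysis.
From mathcomp Require Import ring lra.
Import Order.TTheory GRing.Theory Num.Theory.
Import numFieldNormedType.Exports.
Local Open Scope classical_set_scope.
Local Open Scope ring_scope.

Set Implicit Arguments.
Unset Strict Implicit.
Unset Printing Implicit Defensive.

(** * Inner product and Euclidean norm *)

Definition dot (R : realType) m (u v : 'cV[R]_m) : R := (u^T *m v) 0 0.

Lemma dotE (R : realType) m (u v : 'cV[R]_m) : dot u v = \sum_i u i 0 * v i 0.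
Proof. by rewrite /dot mxE; apply: eq_bigr => i _; rewrite mxE. Qed.

Lemma dotC (R : realType) m (u v : 'cV[R]_m) : dot u v = dot v u.
Proof. by rewrite !dotE; apply: eq_bigr => i _; rewrite mulrC. Qed.

Lemma dotDl (R : realType) m (u v w : 'cV[R]_m) :
  dot (u + v) w = dot u w + dot v w.
Proof. by rewrite /dot linearD mulmxDl mxE. Qed.

Lemma dotZl (R : realType) m c (u v : 'cV[R]_m) :
  dot (c *: u) v = c * dot u v.
Proof. by rewrite /dot linearZ -scalemxAl mxE. Qed.

Lemma dotDr (R : realType) m (u v w : 'cV[R]_m) :
  dot u (v + w) = dot u v + dot u w.
Proof. by rewrite dotC dotDl !(dotC u). Qed.

Lemma dotZr (R : realType) m c (u v : 'cV[R]_m) :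
  dot u (c *: v) = c * dot u v.
Proof. by rewrite dotC dotZl dotC. Qed.

Lemma enorm_ge0 (R : realType) m (v : 'cV[R]_m) : 0 <= enorm v.
Proof. exact: sqrtr_ge0. Qed.

Lemma sqr_enorm (R : realType) m (v : 'cV[R]_m) : enorm v ^+ 2 = dot v v.
Proof.
rewrite sqr_sqrtr; first by rewrite dotE; apply: eq_bigr => i _; rewrite expr2.
by apply: sumr_ge0 => i _; exact: sqr_ge0.
Qed.

Lemma enormZ (R : realType) m c (v : 'cV[R]_m) :
  0 <= c -> enorm (c *: v) = c * enorm v.
Proof.
move=> c0; apply/eqP; rewrite -(@eqrXn2 _ 2) ?mulr_ge0 ?enorm_ge0 //.
by rewrite exprMn !sqr_enorm dotZl dotZr mulrA -expr2.
Qed.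

Lemma sqr_enormD (R : realType) m (u v : 'cV[R]_m) :
  enorm (u + v) ^+ 2 = enorm u ^+ 2 + 2 * dot u v + enorm v ^+ 2.
Proof.
by rewrite !sqr_enorm !dotDl !dotDr (dotC v u); ring.
Qed.

Lemma coord_le_enorm (R : realType) m (v : 'cV[R]_m) i : `|v i 0| <= enorm v.
Proof.
rewrite -(ler_pXn2r (_ : 0 < 2)%N) ?nnegrE ?enorm_ge0 // sqr_enorm dotE.
rewrite real_normK ?num_real // (bigD1 i) //= -expr2 lerDl.
by apply: sumr_ge0 => j _; rewrite -expr2 sqr_ge0.
Qed.

(** * Blocks of a vector and vectors supported on one block *)

Lemma blockE (R : realType) N (n_ : 'I_N -> nat) i
    (x : 'cV[R]_(\sum_i n_ i)) : block i x = submxcol x i.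
Proof.
by rewrite /block -[x in LHS]trmxK -trmx_mul mul_submxrow mulmx1 tr_submxrow
  trmxK.
Qed.

(** Multiplying the partition [1 = [U_1, ..., U_N]] of the identity by [d] gives
    [d = \sum_j U_j d_j], of which only the term [i] survives. *)
Lemma supported_on_block (R : realType) N (n_ : 'I_N -> nat) i
    (d : 'cV[R]_(\sum_i n_ i)) :
  (forall j, j != i -> block j d = 0) -> d = blockU R n_ i *m block i d.
Proof.
move=> dj0; rewrite -[d in LHS]mul1mx -[1%:M]submxrowK -[d in LHS]submxcolK.
rewrite mul_mxrow_mxcol [LHS](bigD1 i) //= -blockE.
rewrite [X in _ + X]big1 ?addr0 // => j ji.
by rewrite -blockE dj0 // mulmx0.
Qed.

Lemma dot_blockU (R : realType) N (n_ : 'I_N -> nat) i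
    (x : 'cV[R]_(\sum_i n_ i)) (s : 'cV[R]_(n_ i)) :
  dot x (blockU R n_ i *m s) = dot (block i x) s.
Proof. by rewrite /dot /block trmx_mul trmxK mulmxA. Qed.

Lemma enorm_supported_on_block (R : realType) N (n_ : 'I_N -> nat) i
    (d : 'cV[R]_(\sum_i n_ i)) :
  (forall j, j != i -> block j d = 0) -> enorm d = enorm (block i d).
Proof.
move=> /supported_on_block dE; apply/eqP.
rewrite -(@eqrXn2 _ 2) ?enorm_ge0 // !sqr_enorm; apply/eqP.
by rewrite {2}dE dot_blockU.
Qed.

Lemma blockD (R : realType) N (n_ : 'I_N -> nat) i
    (x y : 'cV[R]_(\sum_i n_ i)) : block i (x + y) = block i x + block i y.
Proof. exact: mulmxDr. Qed.

(** * Mean value theorem, quadratic estimates and descent along one block *)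

Lemma derive_grad (R : realType) m (f : 'cV[R]_m -> R) (x d : 'cV[R]_m) :
  differentiable f x -> 'D_d f x = dot (grad f x) d.
Proof.
move=> fx; rewrite deriveE // {1}(matrix_sum_delta d) linear_sum dotE.
apply: eq_bigr => i _; rewrite big_ord1 linearZ -deriveE // mulrC.
by rewrite /grad mxE.
Qed.

Lemma MVT_line (R : realType) (V : normedModType R) (f : V -> R) (x d : V) :
  (forall y, differentiable f y) ->
  exists2 c, 0 < c < 1 & f (x + d) - f x = 'D_d f (x + c *: d).
Proof.
move=> df; pose h (c : R) := f (x + c *: d).
have hd (c : R) : is_derive c 1 h ('D_d f (x + c *: d)).
  (* The difference quotients of [h] at [c] are those of [f] at [x + c *: d] along [d], so both
     derivability and the value of the derivative transfer. *)
  have E : (fun e : R => e^-1 *: ((h \o shift c) (e *: 1) - h c)) =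
      (fun e : R =>
         e^-1 *: ((f \o shift (x + c *: d)) (e *: d) - f (x + c *: d))).
    apply/funext => e; rewrite /h /= [e *: 1]mulr1 scalerDl.
    by rewrite addrCA.
  apply: DeriveDef; last by rewrite /derive E.
  by rewrite /derivable E; exact: diff_derivable.
have hc : {within `[0, 1], continuous h}.
  apply: continuous_subspaceT => c.
  by apply: differentiable_continuous; apply/derivable1_diffP; case: (hd c).
have [c c01] := MVT ltr01 (fun c _ => hd c) hc.
rewrite /h scale1r scale0r addr0 subr0 mulr1 => ->.
by exists c => //; move: c01; rewrite in_itv.
Qed.

(** Expanding [0 <= |u - L v|^2] gives [2 L <u, v> <= |u|^2 + L^2 |v|^2 <= 2 L^2 |v|^2]; then divide
    by [2 L]. *)
Lemma dot_le_sqr (R : realType) m (u v : 'cV[R]_m) L : 0 < L ->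
  enorm u <= L * enorm v -> dot u v <= L * enorm v ^+ 2.
Proof.
move=> L0 uLv.
have uLv2 : enorm u ^+ 2 <= L ^+ 2 * enorm v ^+ 2.
  by rewrite -exprMn ler_pXn2r // nnegrE ?enorm_ge0 // mulr_ge0 ?enorm_ge0 ?ltW.
have := sqr_ge0 (enorm (u + - L *: v)).
rewrite sqr_enormD dotZr [enorm (_ *: _) ^+ 2]sqr_enorm dotZl dotZr -sqr_enorm.
move=> H.
rewrite -(ler_pM2l L0) -(ler_pM2l (_ : 0 < 2)) //; lra.
Qed.

Lemma dot_ge_sqr (R : realType) m (u v : 'cV[R]_m) :
  - (2^-1 * enorm u ^+ 2 + 2^-1 * enorm v ^+ 2) <= dot u v.
Proof. by have := sqr_ge0 (enorm (u + v)); rewrite sqr_enormD; lra. Qed.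

Lemma sqr_enormD_le (R : realType) m (u v : 'cV[R]_m) :
  enorm (u + v) ^+ 2 <= 2 * enorm u ^+ 2 + 2 * enorm v ^+ 2.
Proof.
have := sqr_ge0 (enorm (u + -1 *: v)).
rewrite !sqr_enormD dotZr [enorm (_ *: _) ^+ 2]sqr_enorm dotZl dotZr -sqr_enorm.
lra.
Qed.

(* The constant is [L] rather than the usual [L / 2], because the mean value
   theorem replaces the integral of the gradient. *)
Lemma block_descent (R : realType) N (n_ : 'I_N -> nat)
    (f : 'cV[R]_(\sum_i n_ i) -> R) i x (s : 'cV[R]_(n_ i)) L :
  (forall y, differentiable f y) -> 0 < L ->
  (forall c, 0 < c < 1 ->
    enorm (bgrad i f (x + blockU R n_ i *m (c *: s)) - bgrad i f x)
      <= L * enorm (c *: s)) ->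
  f (x + blockU R n_ i *m s) <= f x + dot (bgrad i f x) s + L * enorm s ^+ 2.
Proof.
move=> df L0 lip; have [c c01] := MVT_line x (blockU R n_ i *m s) df.
rewrite derive_grad // dot_blockU => fE; have /andP[c0 c1] := c01.
have := lip c c01; rewrite enormZ ?(ltW c0) // => H.
have /(dot_le_sqr L0) :
    enorm (bgrad i f (x + blockU R n_ i *m (c *: s)) - bgrad i f x)
      <= L * enorm s.
  apply: le_trans H _; rewrite ler_pM2l // ler_piMl ?enorm_ge0 //; exact: ltW.
rewrite dotDl -scaleN1r dotZl -scalemxAr -/(bgrad i f _).
by rewrite /bgrad /= in fE *; rewrite /block in fE; lra.
Qed.

(** * Quadratic minorants, finiteness of the objective, and the prox inequality *)

Lemma prox_bounded_minorant (R : realType) m (h : 'cV[R]_m -> \bar R) :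
  prox_bounded h ->
  exists b c : R, 0 <= c /\ forall v, ((b - c * enorm v ^+ 2)%:E <= h v)%E.
Proof.
move=> [tau [tau0 [b hb]]]; exists b, (2 * tau)^-1; split.
  by rewrite invr_ge0 mulr_ge0 // ltW.
by move=> v; rewrite EFinB leeBlDr //; exact: hb.
Qed.

Lemma dom_objective (R : realType) N (n_ : 'I_N -> nat)
    (f : 'cV[R]_(\sum_i n_ i) -> R) (g : forall i, 'cV[R]_(n_ i) -> \bar R) x :
  (forall i, Defs.proper (g i)) -> Defs.dom (objective f g) x ->
  forall i, g i (block i x) \is a fin_num.
Proof.
move=> g_proper; rewrite /Defs.dom /= /objective => xoo i; rewrite fin_numE.
have gNy j : g j (block j x) != -oo%E by apply/eqP; exact: (g_proper j).1.
rewrite gNy; apply/eqP => giy.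
suff sepy : separable g x = +oo%E by rewrite sepy addey in xoo.
by apply/esum_eqyP => [j _|]; [exact: gNy|exists i].
Qed.

(** Block [i] is split off because a step in that block leaves the remaining sum unchanged. *)
Lemma objective_fin (R : realType) N (n_ : 'I_N -> nat)
    (f : 'cV[R]_(\sum_i n_ i) -> R) (g : forall i, 'cV[R]_(n_ i) -> \bar R)
    i x :
  (forall j, g j (block j x) \is a fin_num) ->
  objective f g x = (f x + (fine (g i (block i x))
    + \sum_(j | j != i) fine (g j (block j x))))%:E.
Proof.
move=> gx; rewrite /objective /separable (bigD1 i) //= !EFinD -sumEFin fineK //.
by congr (_ + (_ + _))%E; apply: eq_bigr => j _; rewrite fineK.
Qed.

(** The prox objective at [x_i + d_i] is at most its value at [x_i]. Once the squares are expanded,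
    the terms [sigma^2 |bgrad|^2 / 2] cancel, and dividing by [sigma] leaves the inequality. *)
Lemma trial_direction_prox (R : realType) N (n_ : 'I_N -> nat)
    (f : 'cV[R]_(\sum_i n_ i) -> R) (g : forall i, 'cV[R]_(n_ i) -> \bar R)
    x i sigma d :
  (forall i, Defs.proper (g i)) -> 0 < sigma -> g i (block i x) \is a fin_num ->
  trial_direction f g x i sigma d ->
  g i (block i (x + d)) \is a fin_num /\
  fine (g i (block i (x + d))) + dot (bgrad i f x) (block i d)
    + (2 * sigma)^-1 * enorm (block i d) ^+ 2 <= fine (g i (block i x)).
Proof.
move=> g_proper s0 gx [_ [u uprox ds]].
have uE : u = block i (x + d) by rewrite blockD ds addrC subrK.
have := uprox (block i x); rewrite uE -[in leRHS](fineK gx).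
have := (g_proper i).1 (block i (x + d)).
(* The value [+oo] would contradict the comparison with the finite value at [x_i]. *)
case: (g i _) => [gu| |] // _; last by rewrite gt0_muley ?lte_fin.
rewrite -!EFinM -!EFinD lee_fin /= => H; split=> //.
rewrite -(ler_pM2l s0); move: H.
have -> : block i x - sigma *: bgrad i f x - block i (x + d) =
  - sigma *: bgrad i f x + -1 *: block i d.
  by rewrite blockD scaleN1r scaleNr opprD addrACA subrr add0r.
have -> : block i x - sigma *: bgrad i f x - block i x = - sigma *: bgrad i f x.
  by rewrite scaleNr addrC addKr.
rewrite sqr_enormD dotZl dotZr [enorm (-1 *: _) ^+ 2]sqr_enorm dotZl dotZr.
rewrite -sqr_enorm.
set D := dot _ _; set S := enorm (block i d) ^+ 2.
have -> : sigma * (gu + D + (2 * sigma)^-1 * S) = sigma * (gu + D) + 2^-1 * S.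
  by field; rewrite gt_eqF.
lra.
Qed.

(** * Acceptance of small stepsizes, first at one point and then near a point *)

Lemma continuous_block (R : realType) N (n_ : 'I_N -> nat) i :
  continuous (@block R N n_ i).
Proof.
move=> x A /nbhs_ballP[e /= e0 xA]; apply/nbhs_ballP; exists e => // y [_ xy].
by apply: xA; split=> // a b; rewrite !blockE !mxE; exact: xy.
Qed.

Lemma continuous_sqr_enorm (R : realType) m :
  continuous (fun v : 'cV[R]_m => enorm v ^+ 2).
Proof.
have -> : (fun v : 'cV[R]_m => enorm v ^+ 2) = (fun v => \sum_i v i 0 * v i 0).
  by apply/funext => v; rewrite sqr_enorm dotE.
apply: continuous_big => [|i _ x]; first exact: add_continuous.
by apply: (@continuousM _ _ (fun v : 'cV[R]_m => v i 0) (fun v => v i 0));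
  apply: coord_continuous.
Qed.

(** The local quantities enter as constants, so that continuity can later fix them on a
    neighborhood. The stepsize bound involving [C] makes the direction shorter than [r], where the
    Lipschitz estimate is available; the one involving [L + a] then gives the decrease. *)
Lemma trial_stops (R : realType) N (n_ : 'I_N -> nat)
    (f : 'cV[R]_(\sum_i n_ i) -> R) (g : forall i, 'cV[R]_(n_ i) -> \bar R)
    (b c : 'I_N -> R) phi0 a C r L x i sigma d :
  (forall y, differentiable f y) -> (forall j, Defs.proper (g j)) ->
  (forall j, 0 <= c j) ->
  (forall j v, ((b j - c j * enorm v ^+ 2)%:E <= g j v)%E) ->
  0 < r -> 0 < L -> 0 <= C -> 0 < sigma ->
  (objective f g x <= phi0%:E)%E ->
  phi0 - f x - \sum_(j | j != i) (b j - c j * enorm (block j x) ^+ 2)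
    - b i + 2 * c i * enorm (block i x) ^+ 2 + 2^-1 * enorm (bgrad i f x) ^+ 2
    <= C ->
  (forall s, enorm (blockU R n_ i *m s) < r ->
    enorm (bgrad i f (x + blockU R n_ i *m s) - bgrad i f x) <= L * enorm s) ->
  L + a <= (2 * sigma)^-1 ->
  2^-1 + 2 * c i + (C + 1) / r ^+ 2 <= (2 * sigma)^-1 ->
  trial_direction f g x i sigma d -> loop_stops f g a x i d.
Proof.
move=> df g_proper c0 gbc r0 L0 C0 s0 xphi0 xC lip sL sC dtrial.
have gx : forall j, g j (block j x) \is a fin_num.
  by apply: (dom_objective (f := f)) => //; exact: le_lt_trans xphi0 (ltry _).
have [gxd prox_le] := trial_direction_prox g_proper s0 (gx i) dtrial.
have [d0 _] := dtrial.
have dE := supported_on_block d0; have dnorm := enorm_supported_on_block d0.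
have gxdj j : j != i -> g j (block j (x + d)) = g j (block j x).
  by move=> ji; rewrite blockD d0 // addr0.
have gxd' j : g j (block j (x + d)) \is a fin_num.
  by have [->//|ji] := eqVneq j i; rewrite gxdj.
right; move: xphi0; rewrite !(objective_fin f i) // -EFinB !lee_fin => xphi0.
rewrite (eq_bigr (fun j => fine (g j (block j x)))); last first.
  by move=> j ji; rewrite gxdj.
have rest : \sum_(j | j != i) (b j - c j * enorm (block j x) ^+ 2) <=
    \sum_(j | j != i) fine (g j (block j x)).
  by apply: ler_sum => j _; rewrite -lee_fin fineK.
have gi : b i - c i * enorm (block i (x + d)) ^+ 2 <=
    fine (g i (block i (x + d))).
  by rewrite -lee_fin fineK.
have cn := ler_wpM2l (c0 i) (sqr_enormD_le (block i x) (block i d)).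
rewrite -blockD in cn.
have dot_lb := dot_ge_sqr (bgrad i f x) (block i d).
have S0 : 0 <= enorm (block i d) ^+ 2 by exact: sqr_ge0.
have sLS := ler_wpM2r S0 sL; have sCS := ler_wpM2r S0 sC.
have small : enorm (block i d) < r.
  rewrite -(@ltr_pXn2r _ 2) ?nnegrE ?enorm_ge0 ?ltW //.
  have r2 : 0 < r ^+ 2 by rewrite exprn_gt0.
  (* The prox inequality, the minorant of [g i] at [x + d] and the lower bound on the inner product
     combine to [((2 sigma)^-1 - 2^-1 - 2 c_i) |d_i|^2 <= C]; [C + 1] makes the conclusion
     strict. *)
  have : (C + 1) / r ^+ 2 * enorm (block i d) ^+ 2 < C + 1 by lra.
  by rewrite mulrAC ltr_pdivrMr // ltr_pM2l // ltr_wpDl.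
have fd : f (x + d) <= f x + dot (bgrad i f x) (block i d)
    + L * enorm (block i d) ^+ 2.
  rewrite {1}dE; apply: block_descent => // t /andP[t0 t1].
  apply: lip; rewrite -scalemxAr -dE enormZ ?(ltW t0) // dnorm.
  by rewrite (le_lt_trans _ small) // ler_piMl ?enorm_ge0 // ltW.
(* Adding the prox inequality to [fd] cancels the gradient terms. *)
by rewrite dnorm; lra.
Qed.

Lemma common_minorants (R : realType) N (n_ : 'I_N -> nat)
    (g : forall i, 'cV[R]_(n_ i) -> \bar R) :
  (forall i, prox_bounded (g i)) ->
  exists b c : 'I_N -> R, (forall j, 0 <= c j) /\
    forall j v, ((b j - c j * enorm v ^+ 2)%:E <= g j v)%E.
Proof.
move=> gpb.
have /choice[bc bcP] : forall j, exists p : R * R, 0 <= p.2 /\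
    forall v, ((p.1 - p.2 * enorm v ^+ 2)%:E <= g j v)%E.
  by move=> j; have [b [c bc]] := prox_bounded_minorant (gpb j); exists (b, c).
by exists (fst \o bc), (snd \o bc); split=> [j|j v]; have [] := bcP j.
Qed.

Lemma continuous_sqr_block (R : realType) N (n_ : 'I_N -> nat) i :
  continuous (fun x : 'cV[R]_(\sum_i n_ i) => enorm (block i x) ^+ 2).
Proof.
move=> x; apply: (@continuous_comp _ _ _ (@block R N n_ i)
  (fun v => enorm v ^+ 2)); [exact: continuous_block|].
exact: continuous_sqr_enorm.
Qed.

Lemma continuous_minorant_sum (R : realType) N (n_ : 'I_N -> nat)
    (b c : 'I_N -> R) (Q : pred 'I_N) :
  continuous (fun x : 'cV[R]_(\sum_i n_ i) =>
    \sum_(j | Q j) (b j - c j * enorm (block j x) ^+ 2)).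
Proof.
apply: continuous_big => [|j _ x]; first exact: add_continuous.
apply: (@continuousB _ _ _ (fun=> b j) (fun x => c j * enorm (block j x) ^+ 2)).
  exact: cst_continuous.
apply: (@continuousM _ _ (fun=> c j) (fun x => enorm (block j x) ^+ 2)).
  exact: cst_continuous.
exact: continuous_sqr_block.
Qed.

Lemma objective_large_near (R : realType) N (n_ : 'I_N -> nat)
    (f : 'cV[R]_(\sum_i n_ i) -> R) (g : forall i, 'cV[R]_(n_ i) -> \bar R)
    xbar M :
  standing_assumption f g -> ~ Defs.dom (separable g) xbar ->
  \forall x \near xbar, (M%:E < objective f g x)%E.
Proof.
move=> [[df _] _ g_proper g_lsc g_pb _] xbarN.
have [b [c [c0 gbc]]] := common_minorants g_pb.
have [i [_ _ giy]] : exists i, [/\ i \in index_enum 'I_N, true &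
    g i (block i xbar) = +oo%E].
  apply/esum_eqyP => [j _|]; first by apply/eqP; exact: (g_proper j).1.
  by apply/eqP; rewrite -leye_eq leNgt; apply/negP.
(* [psi] is a continuous minorant of all of the objective except [g i], the term that is infinite at
   [xbar]. *)
pose psi : _ -> R := f + (fun x =>
    \sum_(j | j != i) (b j - c j * enorm (block j x) ^+ 2)).
have psi_cont : {for xbar, continuous psi}.
  apply: continuousD; first exact: differentiable_continuous.
  exact: continuous_minorant_sum.
(* The extra [1] pays for the unit by which [psi] may drop near [xbar]. *)
have [|V V_nbhs gV] := g_lsc i (block i xbar) (M - psi xbar + 1).
  by rewrite giy ltry.
have nV : \forall x \near xbar, V (block i x) by exact: continuous_block.
have npsi : \forall x \near xbar, psi xbar - 1 < psi x.
  by apply: (cvgr_gt _ psi_cont); rewrite ltrBlDr ltrDl.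
apply: filterS2 nV npsi => x /gV gix psix.
have lb : ((psi x)%:E + g i (block i x) <= objective f g x)%E.
  rewrite /objective /separable [X in (_ <= _ + X)%E](bigD1 i) //= EFinD -addeA.
  rewrite leeD2lE // addeC leeD2l // -sumEFin; apply: lee_sum => j _.
  exact: gbc.
apply: lt_le_trans lb; case: (g i (block i x)) gix => [z| |] //.
  by rewrite -EFinD !lte_fin; lra.
by move=> _; rewrite addey // ltry.
Qed.

Lemma trial_stops_near (R : realType) N (n_ : 'I_N -> nat)
    (f : 'cV[R]_(\sum_i n_ i) -> R) (g : forall i, 'cV[R]_(n_ i) -> \bar R)
    (a phi0 : R) i (xbar : 'cV[R]_(\sum_i n_ i)) :
  standing_assumption f g -> 0 < a ->
  \forall x \near nbhs xbar & sigma \near (0 : R)^'+,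
    (objective f g x <= phi0%:E)%E ->
    forall d, trial_direction f g x i sigma d -> loop_stops f g a x i d.
Proof.
move=> hfg a0; have [[df grad_cont] lip g_proper _ g_pb _] := hfg.
have [xdom|xNdom] := pselect (Defs.dom (separable g) xbar); last first.
  have H := objective_large_near phi0 hfg xNdom.
  (* On this neighborhood the sublevel condition fails, so any stepsize will do. *)
  exists ([set x | (phi0%:E < objective f g x)%E], setT).
    by split=> //; exact: filterT.
  by move=> [x sigma] /= [/lt_geF -> _].
have [b [c [c0 gbc]]] := common_minorants g_pb.
have [V [L /(_ i) [V_nbhs _ L0 VL]]] := lip _ xdom.
have /nbhs_ballP[e /= e0 eV] := V_nbhs.
(* Half of the radius is for moving [x] away from [xbar], half for the displacement along the
   block. *)
pose r := e / 2; have r0 : 0 < r by rewrite divr_gt0.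
(* [Cx] is the quantity that [trial_stops] requires to be at most [C], as a function of the
   point. *)
pose Cx : _ -> R := cst phi0 - f
    - (fun x => \sum_(j | j != i) (b j - c j * enorm (block j x) ^+ 2))
    - cst (b i) + cst (2 * c i) \* (fun x => enorm (block i x) ^+ 2)
    + cst 2^-1 \* (fun x => enorm (bgrad i f x) ^+ 2).
have Cx_cont : {for xbar, continuous Cx}.
  apply: continuousD; [apply: continuousD; [apply: continuousB;
    [apply: continuousB; [apply: continuousB|]|]|]|].
  - exact: cst_continuous.
  - exact: differentiable_continuous.
  - exact: continuous_minorant_sum.
  - exact: cst_continuous.
  - by apply: continuousM; [exact: cst_continuous|exact: continuous_sqr_block].
  - apply: continuousM; first exact: cst_continuous.
    apply: (@continuous_comp _ _ _ (grad f) (fun y => enorm (block i y) ^+ 2)).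
      exact: grad_cont.
    exact: continuous_sqr_block.
pose C : R := `|Cx xbar| + 1; have C0 : 0 <= C by rewrite addr_ge0.
have nC : \forall x \near xbar, Cx x < C.
  by apply: (cvgr_lt _ Cx_cont); rewrite ltr_pwDr // ler_norm.
(* Both lower bounds that [trial_stops] puts on [(2 sigma)^-1] are nonnegative, so their sum
   dominates each. *)
pose K := L i + a + (2^-1 + 2 * c i + (C + 1) / r ^+ 2).
have K2 : 0 < 2^-1 + 2 * c i + (C + 1) / r ^+ 2.
  rewrite ltr_pwDr ?addr_ge0 ?mulr_ge0 ?invr_ge0 //.
  by rewrite divr_gt0 ?exprn_gt0 // ltr_wpDl.
have K0 : 0 < K by rewrite /K addr_gt0 // addr_gt0.
have nr : \forall x \near xbar, ball xbar r x by apply: nbhsx_ballx.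
exists ([set x | Cx x < C /\ ball xbar r x],
        [set sigma | 0 < sigma /\ sigma < (2 * K)^-1]) => /=.
  split; first exact: filterS2 nC nr => x.
  have K20 : 0 < (2 * K)^-1 by rewrite invr_gt0 mulr_gt0.
  exact: filterS2 (nbhs_right_gt 0) (nbhs_right_lt K20) => sigma.
move=> [x sigma] /= [[xC xr] [s0 sK]] xphi0 d.
have KsV : K <= (2 * sigma)^-1.
  rewrite -[K]invrK lef_pV2 ?posrE ?invr_gt0 ?mulr_gt0 //.
  by move: sK; rewrite invfM => /ltW; lra.
apply: (trial_stops (r := r) (L := L i) df g_proper c0 gbc r0 L0 C0 s0 xphi0
  (ltW xC)).
- move=> s sr; apply: VL; apply: eV.
    by apply: le_ball xr; rewrite /r; lra.
  (* Balls are those of the sup norm, which the Euclidean norm dominates. *)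
  rewrite (splitr e); apply: ball_triangle xr _; split=> // p q.
  rewrite (ord1 q) mxE /ball /= opprD addNKr normrN.
  exact: le_lt_trans (coord_le_enorm _ _) sr.
- by apply: le_trans KsV; rewrite /K lerDl ltW.
- by apply: le_trans KsV; rewrite /K lerDr addr_ge0 // ltW.
Qed.

(** * Monotonicity along the iterates, compactness, and the stepsize matrix *)

Lemma leeB_ge0 (R : realType) (y : \bar R) (r : R) :
  0 <= r -> (y - r%:E <= y)%E.
Proof. by move=> r0; rewrite leeBlDr // leeDl // lee_fin. Qed.

Lemma arbpg_descent (R : realType) N (n_ : 'I_N -> nat)
    (P : arbpg_params R N) (f : 'cV[R]_(\sum_i n_ i) -> R)
    (g : forall i, 'cV[R]_(n_ i) -> \bar R) x ik tau k :
  arbpg P f g x ik tau -> (objective f g (x k) <= objective f g (x 0%N))%E.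
Proof.
move=> [_ [taubar [t [d run]]]]; elim: k => // k; apply: le_trans.
have [/(_ (ik k))[[_ _ _ _ stops] _] upd] := run k.
case: upd => [[_ ->//]|[dN0 [lambda [lambda0 extrap ->]]]].
apply: le_trans extrap _; apply: le_trans (leeB_ge0 _ _) _.
  by rewrite mulr_ge0 ?sqr_ge0 // mulr_ge0 ?sqr_ge0 // ltW // dec_alpha_gt0.
case: stops => [//|]; move/le_trans; apply; apply: leeB_ge0.
by rewrite mulr_ge0 ?sqr_ge0 // ltW // dec_a_gt0.
Qed.

(** The box is the continuous image under transposition of a box of row vectors, compact as a
    product of segments. *)
Lemma compact_coord_box (R : realType) m (M : R) :
  compact [set v : 'cV[R]_m | forall i, `[- M, M]%classic (v i 0)].
Proof.
pose B := [set w : 'rV[R]_m | forall i, `[- M, M]%classic (w ord0 i)].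
have -> : [set v : 'cV[R]_m | forall i, `[- M, M]%classic (v i 0)] = trmx @` B.
  apply/seteqP; split=> [v vM|_ [w wM <-] i]; last by rewrite mxE; exact: wM.
  by exists v^T; [move=> i; rewrite mxE; exact: vM|rewrite trmxK].
apply: continuous_compact.
  apply: continuous_subspaceT => w A /nbhs_ballP[e /= e0 eA].
  apply/nbhs_ballP; exists e => // y [_ wy].
  by apply: eA; split=> // i j; rewrite !mxE; exact: wy.
exact: (@rV_compact R m (fun=> `[- M, M]%classic)
  (fun=> @segment_compact _ _ _)).
Qed.

(** [tagnat.sig1 p] is the block to which the coordinate [p] belongs. *)
Lemma ThetaE (R : realType) N (n_ : 'I_N -> nat) (tau : nat -> 'I_N -> R) k :
  Theta n_ tau k = diag_mx (\row_p tau k (tagnat.sig1 p)).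
Proof.
apply/matrixP => p q; rewrite /Theta /blockU !mxE tagnat.sig2K.
by rewrite mulr_natr; case: eqVneq => [->|].
Qed.

Lemma Theta_ge (R : realType) N (n_ : 'I_N -> nat) (tau : nat -> 'I_N -> R)
    k theta :
  (forall i, theta <= tau k i) -> loewner_ge (Theta n_ tau k) theta%:M.
Proof.
move=> le_tau; rewrite /loewner_ge ThetaE -diag_const_mx -linearB /=.
set D := _ - _; split=> [|v]; first exact: tr_diag_mx.
rewrite mul_mx_diag mxE; apply: sumr_ge0 => p _.
rewrite !mxE mulrAC -expr2 mulr_ge0 ?sqr_ge0 //.
by rewrite subr_ge0.
Qed.

Theorem proposition4p2 (R : realType) (N : nat) (n_ : 'I_N -> nat)
    (f : 'cV[R]_(\sum_i n_ i) -> R) (g : forall i, 'cV[R]_(n_ i) -> \bar R)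
    (P : arbpg_params R N)
    (x : nat -> 'cV[R]_(\sum_i n_ i)) (ik : nat -> 'I_N)
    (tau : nat -> 'I_N -> R) (kj : nat -> nat)
    (hN : (1 <= N)%N)
    (hfg : standing_assumption f g)
    (hx : arbpg P f g x ik tau)
    (hkj : {homo kj : j j' / (j < j')%N})
    (hbounded : exists M : R, forall j, enorm (x (kj j)) <= M) :
  exists2 theta : R, 0 < theta
    & forall j, loewner_ge (Theta n_ tau (kj j)) theta%:M.
Proof.
have [M xM] := hbounded.
have [x0dom [taubar [t [d run]]]] := hx.
have [phi0 phi0E] : exists phi0, objective f g (x 0%N) = phi0%:E.
  have i0 := Ordinal hN; exists (f (x 0%N) + (fine (g i0 (block i0 (x 0%N)))
    + \sum_(j | j != i0) fine (g j (block j (x 0%N))))).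
  apply: objective_fin => j; apply: dom_objective x0dom _.
  exact: sa_proper hfg.
have stops : \forall sigma \near (0 : R)^'+, forall i j,
    forall e, trial_direction f g (x (kj j)) i sigma e ->
    loop_stops f g (dec_a P) (x (kj j)) i e.
  apply: filter_forall => i.
  have /compact_near_coveringP box := @compact_coord_box R (\sum_i n_ i) M.
  (* Since [y] ranges over the whole box, the sublevel condition is part of the predicate; the
     iterates satisfy it by [arbpg_descent]. *)
  have H := box R (0 : R)^'+ (fun sigma y => (objective f g y <= phi0%:E)%E ->
    forall e, trial_direction f g y i sigma e -> loop_stops f g (dec_a P) y i e)
    _ (fun y _ => trial_stops_near phi0 i y hfg (dec_a_gt0 P)).
  apply: filterS (H _) => {H} sigma H j e; apply: H.
    move=> p /=; rewrite in_itv /= -ler_norml.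
    exact: le_trans (coord_le_enorm _ _) (xM j).
  by rewrite -phi0E; exact: arbpg_descent hx.
have [eps /= eps0 epsP] := stops.
have b0 := shrink_gt0 P; have lo0 := tau_lo_gt0 P.
(* The first bound serves a loop that accepts its initial trial stepsize, the second a loop with at
   least one rejection. *)
exists (Num.min (tau_lo P) (shrink P * (eps / 2))).
  by rewrite lt_min lo0 !mulr_gt0 // invr_gt0.
move=> j; apply: Theta_ge => i.
have [/(_ i)[[lo _ trial Nstops _] ->] _] := run (kj j).
case tE : (t (kj j) i) => [|s]; first by rewrite expr0 mul1r ge_min lo.
(* With counter [s.+1] the accepted stepsize is [shrink P] times the one rejected at [s]; if that
   were below [eps / 2], it would have stopped the loop. *)
rewrite ge_min; apply/orP; right; rewrite exprS -mulrA ler_pM2l //.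
rewrite leNgt; apply/negP => small.
have := Nstops s; rewrite tE ltnS leqnn => /(_ isT); apply.
have sigma0 : 0 < shrink P ^+ s * taubar (kj j) i.
  by rewrite mulr_gt0 ?exprn_gt0 // (lt_le_trans lo0).
apply: (epsP (shrink P ^+ s * taubar (kj j) i)) => //.
  rewrite /ball_ /= sub0r normrN gtr0_norm // (lt_le_trans small) //.
  by rewrite ler_pdivrMr // ler_pMr //; lra.
by apply: trial; rewrite tE.
Qed.
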